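(* Let $A$ be a Jordan algebra over a field $F$ of characteristic $\neq 2$. The following conditions are equivalent: (a) $A$ is a BJ-algebra; (b) $A$ is an RJ-algebra and the set of all idempotents of $A$ (with the order $e\leq f$ iff $ef=e$) is a complete lattice.
   Context: For a Jordan algebra $A$ over a field $F$ of characteristic $\neq 2$ (not assumed unital), write $A^2=\{a^2: a\in A\}$, $U_ab=2(ab)a-a^2b$, $U_a(A)=\{U_ax: x\in A\}$, and for $S\subseteq A$ put ${}^\perp S=\{x\in A: U_ax=0 \text{ for all } a\in S\}$. An idempotent is an element $e$ with $e^2=e$ (zero is allowed). $A$ is called an RJ-algebra if for every $x\in A$ there exists an idempotent $e\in A$ such that ${}^\perp\{x\}\cap A^2=U_e(A)\cap A^2$. $A$ is called a BJ-algebra if for every subset $S\subseteq A$ there exists an idempotent $e\in A$ such that ${}^\perp S\cap A^2=U_e(A)\cap A^2$. For idempotents $e,f\in A$ one writes $e\leq f$ if $e\in U_f(A)$, equivalently $ef=e$, equivalently $U_e(A)\subseteq U_f(A)$. *)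

(* Defs.v *)
From HB Require Import structures.
From mathcomp Require Import all_boot all_algebra.
From mathcomp Require Import boolp classical_sets.

Set Implicit Arguments.
Unset Strict Implicit.
Unset Printing Implicit Defensive.

Import GRing.Theory.
Local Open Scope ring_scope.
Local Open Scope classical_set_scope.

Reserved Notation "x *_J y" (at level 40, left associativity).

(* Linear Jordan algebras, not assumed unital. The characteristic is left
   unconstrained here; a statement about such an algebra should assume it
   different from 2. By commutativity, linearity on the left is enough. *)
HB.mixin Record isJordanAlgebra (F : fieldType) (A : Type)
    of GRing.Lmodule F A := {
  jmul : A -> A -> A;
  jmulC : commutative jmul;
  jmulDl : left_distributive jmul +%R;
  jmulZl : forall (c : F) (x y : A), jmul (c *: x) y = c *: jmul x y;
  jordan_identity : forall x y : A,
    jmul (jmul (jmul x x) y) x = jmul (jmul x x) (jmul y x)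
}.

#[short(type="jordanAlgType")]
HB.structure Definition JordanAlgebra (F : fieldType) :=
  { A of isJordanAlgebra F A & GRing.Lmodule F A }.

Notation "x *_J y" := (jmul x y) : ring_scope.

Section JordanAlgebraDefs.
Variables (F : fieldType) (A : jordanAlgType F).
Implicit Types (a b e f x : A) (S : set A).

Definition jsquares : set A := [set a *_J a | a in [set: A]].

Definition jU a b : A := ((a *_J b) *_J a) *+ 2 - (a *_J a) *_J b.

Definition jU_image a : set A := [set jU a x | x in [set: A]].

Definition lperp S : set A := [set x | forall a, S a -> jU a x = 0].

Definition idempotents : set A := [set e | e *_J e = e].

Definition idem_le e f : Prop := e *_J f = e.

Definition RJ_algebra : Prop :=
  forall x, exists2 e, idempotents e &
    lperp [set x] `&` jsquares = jU_image e `&` jsquares.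

Definition BJ_algebra : Prop :=
  forall S, exists2 e, idempotents e &
    lperp S `&` jsquares = jU_image e `&` jsquares.

End JordanAlgebraDefs.

Arguments idempotents {F} A.
Arguments RJ_algebra {F} A.
Arguments BJ_algebra {F} A.

Section CompleteLattice.
Variables (T : Type) (D : set T) (le : T -> T -> Prop).

Definition partial_order_on : Prop :=
  [/\ forall x, D x -> le x x,
      forall x y, D x -> D y -> le x y -> le y x -> x = y
    & forall y x z, D x -> D y -> D z -> le x y -> le y z -> le x z].

Definition is_lub_in (S : set T) (u : T) : Prop :=
  [/\ D u, forall x, S x -> le x u
    & forall v, D v -> (forall x, S x -> le x v) -> le u v].

Definition is_glb_in (S : set T) (l : T) : Prop :=
  [/\ D l, forall x, S x -> le l x
    & forall v, D v -> (forall x, S x -> le v x) -> le v l].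

Definition complete_lattice_on : Prop :=
  partial_order_on /\
  forall S : set T, S `<=` D ->
    (exists u, is_lub_in S u) /\ (exists l, is_glb_in S l).

End CompleteLattice.

(* Main.v *)
Require Import Defs.
From HB Require Import structures.
From mathcomp Require Import all_boot all_algebra.
From mathcomp Require Import boolp classical_sets.

Set Implicit Arguments.
Unset Strict Implicit.
Unset Printing Implicit Defensive.

Import GRing.Theory.
Local Open Scope ring_scope.
Local Open Scope classical_set_scope.

(**
The Peirce decomposition with respect to an idempotent drives everything. In
an RJ-algebra the idempotent [u] attached to [0] acts as a unit on all
products, and [u - s] is the idempotent attached to an idempotent [s]. Hence,
if [U_s p = 0] for idempotents [s, p], then [s p = 0]. Applied to idempotents
of the form [g - t^2 + t], with [t] in the Peirce space [A_{1/2}(g)], this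
shows that [t = 0] as soon as [t^2] lies in [A_1(g)]; in particular
[U_x g = 0] forces the [1/2]-component of [x] to vanish. From this one gets
that the idempotent [f] attached to a square [a] satisfies [f a = 0], that is,
[a] is supported by [u - f].

If [A] is BJ, the idempotent attached to [{u - s | s in S}] is the infimum of
[S]. Conversely, the infimum of the idempotents attached to the elements of
[S] is attached to [S], since a square lying in all their Peirce 1-spaces has
its support [u - f] below all of them.
*)

(** * Bilinearity of the Jordan product *)

Section JordanBilinearity.
Variables (F : fieldType) (A : jordanAlgType F).
Implicit Types x y z : A.

Lemma jmulDr x y z : x *_J (y + z) = x *_J y + x *_J z.
Proof. by rewrite !(jmulC x) jmulDl. Qed.

Lemma jmul0l x : 0 *_J x = 0.
Proof. by apply: (addrI (0 *_J x)); rewrite -jmulDl !addr0. Qed.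

Lemma jmul0r x : x *_J 0 = 0.
Proof. by rewrite jmulC jmul0l. Qed.

Lemma jmulNl x y : (- x) *_J y = - (x *_J y).
Proof. by apply/eqP; rewrite -addr_eq0 -jmulDl addNr jmul0l. Qed.

Lemma jmulNr x y : x *_J (- y) = - (x *_J y).
Proof. by rewrite jmulC jmulNl jmulC. Qed.

Lemma jmulMnl x y n : (x *+ n) *_J y = (x *_J y) *+ n.
Proof. by elim: n => [|n IH]; rewrite ?mulr0n ?jmul0l // !mulrS jmulDl IH. Qed.

Lemma jmulMnr x y n : x *_J (y *+ n) = (x *_J y) *+ n.
Proof. by rewrite jmulC jmulMnl jmulC. Qed.

Lemma jmulMzl x y (n : int) : (x *~ n) *_J y = (x *_J y) *~ n.
Proof. by case: n => n; rewrite ?NegzE ?mulrNz ?jmulNl -pmulrn jmulMnl. Qed.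

Lemma jmulMzr x y (n : int) : x *_J (y *~ n) = (x *_J y) *~ n.
Proof. by rewrite jmulC jmulMzl jmulC. Qed.

Lemma jmulZr (c : F) x y : x *_J (c *: y) = c *: (x *_J y).
Proof. by rewrite jmulC jmulZl jmulC. Qed.

End JordanBilinearity.

(** * Deciding identities of commutative nonassociative algebras *)

Inductive mono := Leaf of nat | Node of mono & mono.

Fixpoint mono_eqb (m1 m2 : mono) : bool :=
  match m1, m2 with
  | Leaf i, Leaf j => eqn i j
  | Node a b, Node c d => mono_eqb a c && mono_eqb b d
  | _, _ => false
  end.

Fixpoint mono_leb (m1 m2 : mono) : bool :=
  match m1, m2 with
  | Leaf i, Leaf j => leq i j
  | Leaf _, Node _ _ => true
  | Node _ _, Leaf _ => false
  | Node a b, Node c d => if mono_eqb a c then mono_leb b d else mono_leb a c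
  end.

(** Sorting the factors gives one normal form to monomials equal up to commutativity. *)
Definition mono_mul m1 m2 := if mono_leb m1 m2 then Node m1 m2 else Node m2 m1.

Definition jpoly := seq (int * mono).

Fixpoint jpoly_insert (c : int) (m : mono) (p : jpoly) : jpoly :=
  match p with
  | [::] => [:: (c, m)]
  | (d, n) :: q => if mono_eqb m n then (c + d, n) :: q
                   else (d, n) :: jpoly_insert c m q
  end.

Definition jpoly_add (p q : jpoly) : jpoly :=
  foldr (fun cm => jpoly_insert cm.1 cm.2) q p.

Definition jpoly_scale (n : int) (p : jpoly) : jpoly :=
  [seq (n * cm.1, cm.2) | cm <- p].

Definition jpoly_mul1 (c : int) (m : mono) (p : jpoly) : jpoly :=
  [seq (c * cm.1, mono_mul m cm.2) | cm <- p].

Definition jpoly_mul (p q : jpoly) : jpoly :=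
  foldr (fun cm => jpoly_add (jpoly_mul1 cm.1 cm.2 q)) [::] p.

Inductive jexpr :=
  | JVar of nat
  | JZero
  | JAdd of jexpr & jexpr
  | JOpp of jexpr
  | JMuln of jexpr & nat
  | JHalf of jexpr
  | JMul of jexpr & jexpr.

(* An upper bound on the exponent of 2 in the denominators of an expression. *)
Fixpoint jdenom (x : jexpr) : nat :=
  match x with
  | JVar _ | JZero => 0
  | JAdd y z => maxn (jdenom y) (jdenom z)
  | JOpp y | JMuln y _ => jdenom y
  | JHalf y => (jdenom y).+1
  | JMul y z => (jdenom y + jdenom z)%N
  end.

(* The expansion of [2 ^ jdenom x] times [x], so that coefficients are
   integers. *)
Fixpoint jnorm (x : jexpr) : jpoly :=
  match x with
  | JVar i => [:: (1, Leaf i)]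
  | JZero => [::]
  | JAdd y z =>
    let d := maxn (jdenom y) (jdenom z) in
    jpoly_add (jpoly_scale (2 ^ (d - jdenom y))%N (jnorm y))
              (jpoly_scale (2 ^ (d - jdenom z))%N (jnorm z))
  | JOpp y => jpoly_scale (-1) (jnorm y)
  | JMuln y n => jpoly_scale n (jnorm y)
  | JHalf y => jnorm y
  | JMul y z => jpoly_mul (jnorm y) (jnorm z)
  end.

Definition jcheck (x y : jexpr) : bool :=
  all (fun cm => cm.1 == 0) (jnorm (JAdd x (JOpp y))).

Section Reflection.
Variables (F : fieldType) (A : jordanAlgType F).
Hypothesis two_neq0 : 2%:R != 0 :> F.
Variable env : seq A.

Fixpoint mono_eval (m : mono) : A :=
  match m with
  | Leaf i => nth 0 env i
  | Node m1 m2 => mono_eval m1 *_J mono_eval m2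
  end.

Fixpoint jpoly_eval (p : jpoly) : A :=
  if p is (c, m) :: q then mono_eval m *~ c + jpoly_eval q else 0.

Fixpoint jeval (x : jexpr) : A :=
  match x with
  | JVar i => nth 0 env i
  | JZero => 0
  | JAdd y z => jeval y + jeval z
  | JOpp y => - jeval y
  | JMuln y n => jeval y *+ n
  | JHalf y => 2%:R^-1 *: jeval y
  | JMul y z => jeval y *_J jeval z
  end.

Lemma two_torsion_free k (x : A) : x *+ 2 ^ k = 0 -> x = 0.
Proof.
rewrite -scaler_nat natrX => /eqP; rewrite scaler_eq0 expf_eq0 (negPf two_neq0).
by rewrite andbF => /eqP.
Qed.

Lemma scale_halfD (x : A) : (2%:R^-1 *: x) *+ 2 = x.
Proof. by rewrite -scaler_nat scalerA divff // scale1r. Qed.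

Lemma mono_eqbP m1 m2 : mono_eqb m1 m2 -> m1 = m2.
Proof.
elim: m1 m2 => [i|a IHa b IHb] [j|c d] //=; first by move/eqnP->.
by case/andP=> /IHa -> /IHb ->.
Qed.

Lemma mono_mul_eval m1 m2 :
  mono_eval (mono_mul m1 m2) = mono_eval m1 *_J mono_eval m2.
Proof. by rewrite /mono_mul; case: ifP => //= _; rewrite jmulC. Qed.

Lemma jpoly_insert_eval c m p :
  jpoly_eval (jpoly_insert c m p) = mono_eval m *~ c + jpoly_eval p.
Proof.
elim: p => [|[d n] q IH] //=; case: ifP => [/mono_eqbP ->|_] /=.
  by rewrite mulrzDr addrA.
by rewrite IH addrCA.
Qed.

Lemma jpoly_add_eval p q :
  jpoly_eval (jpoly_add p q) = jpoly_eval p + jpoly_eval q.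
Proof.
elim: p => [|[c m] p IH] /=; first by rewrite add0r.
by rewrite jpoly_insert_eval IH addrA.
Qed.

Lemma jpoly_scale_eval n p :
  jpoly_eval (jpoly_scale n p) = jpoly_eval p *~ n.
Proof.
elim: p => [|[c m] p IH] /=; first by rewrite mul0rz.
by rewrite IH mulrzDl mulrzA_C.
Qed.

Lemma jpoly_mul1_eval c m p :
  jpoly_eval (jpoly_mul1 c m p) = (mono_eval m *~ c) *_J jpoly_eval p.
Proof.
elim: p => [|[d n] p IH] /=; first by rewrite jmul0r.
by rewrite IH mono_mul_eval jmulDr jmulMzr !jmulMzl -!mulrzA.
Qed.

Lemma jpoly_mul_eval p q :
  jpoly_eval (jpoly_mul p q) = jpoly_eval p *_J jpoly_eval q.
Proof.
elim: p => [|[c m] p IH] /=; first by rewrite jmul0l.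
by rewrite jpoly_add_eval jpoly_mul1_eval IH jmulDl.
Qed.

Lemma jnorm_eval x : jpoly_eval (jnorm x) = jeval x *+ 2 ^ jdenom x.
Proof.
elim: x => [i||y IHy z IHz|y IHy|y IHy n|y IHy|y IHy z IHz] /=.
- by rewrite addr0 expn0 mulr1n.
- by rewrite mul0rn.
- rewrite jpoly_add_eval !jpoly_scale_eval IHy IHz -!pmulrn -!mulrnA mulrnDl.
  by rewrite -!expnD !subnKC ?leq_maxl ?leq_maxr.
- by rewrite jpoly_scale_eval IHy mulrN1z mulNrn.
- by rewrite jpoly_scale_eval IHy -pmulrn -!mulrnA mulnC.
- by rewrite IHy expnS mulrnA scale_halfD.
- by rewrite jpoly_mul_eval IHy IHz jmulMnl jmulMnr -mulrnA expnD mulnC.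
Qed.

Lemma jcheck_sound x y : jcheck x y = true -> jeval x = jeval y.
Proof.
rewrite /jcheck => chk; apply/eqP; rewrite -subr_eq0; apply/eqP.
apply: (@two_torsion_free (jdenom (JAdd x (JOpp y)))).
rewrite -(jnorm_eval (JAdd x (JOpp y))).
elim: (jnorm _) chk => [|[c m] p IH] //= /andP[/eqP -> /IH ->].
by rewrite mulr0z addr0.
Qed.

End Reflection.

(** * Reification of goals *)

Ltac jlookup env t :=
  lazymatch env with
  | t :: _ => constr:(0%N)
  | _ :: ?s => let i := jlookup s t in constr:(S i)
  end.

Ltac jatom env t :=
  match env with
  | _ => let i := jlookup env t in constr:((env, JVar i))
  | _ => let env' := constr:(rcons env t) in
         let env' := eval cbv [rcons] in env' in
         let i := jlookup env' t in constr:((env', JVar i))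
  end.

Ltac jreify env t :=
  lazymatch t with
  | @GRing.zero _ => constr:((env, JZero))
  | @GRing.add _ ?x ?y =>
    let r := jreify env x in
    lazymatch r with (?env1, ?ex) =>
      let s := jreify env1 y in
      lazymatch s with (?env2, ?ey) => constr:((env2, JAdd ex ey)) end end
  | @GRing.opp _ ?x =>
    let r := jreify env x in
    lazymatch r with (?env1, ?ex) => constr:((env1, JOpp ex)) end
  | @GRing.natmul _ ?x ?n =>
    let r := jreify env x in
    lazymatch r with (?env1, ?ex) => constr:((env1, JMuln ex n)) end
  (* The scalar is not inspected; one other than [2^-1] makes the final [exact] ill-typed. *)
  | @GRing.scale _ _ _ ?x =>
    let r := jreify env x in
    lazymatch r with (?env1, ?ex) => constr:((env1, JHalf ex)) end
  | @jmul _ _ ?x ?y =>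
    let r := jreify env x in
    lazymatch r with (?env1, ?ex) =>
      let s := jreify env1 y in
      lazymatch s with (?env2, ?ey) => constr:((env2, JMul ex ey)) end end
  | _ => jatom env t
  end.

(* Proves an identity valid in every commutative nonassociative algebra in
   which 2 is invertible; the only scalar allowed is [2^-1], and [two_neq0]
   is a proof that 2 is nonzero. *)
Ltac jalg two_neq0 :=
  lazymatch goal with |- @eq ?T ?x ?y =>
    let r := jreify (@nil T) x in
    lazymatch r with (?env1, ?ex) =>
      let s := jreify env1 y in
      lazymatch s with (?env2, ?ey) =>
        exact (@jcheck_sound _ _ two_neq0 env2 ex ey
                 (@eq_refl bool true <: jcheck ex ey = true))
      end end end.

Lemma eq_lin (V : zmodType) n (X Y x y : V) :
  X = Y -> x - y = (X - Y) *+ n -> x = y.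
Proof.
by move=> ->; rewrite subrr mul0rn => /eqP; rewrite subr_eq0 => /eqP.
Qed.

(* Subtracts [n] times the equation [H] from the goal. *)
Ltac lin n H := apply: (@eq_lin _ n _ _ _ _ H).

(** * Peirce decomposition *)

Section Peirce.
Variables (F : fieldType) (A : jordanAlgType F).
Hypothesis two_neq0 : 2%:R != 0 :> F.
Implicit Types a b e s t x y z w : A.

Local Notation half x := (2%:R^-1 *: x).

Lemma jordan_linearized x z w y :
  (x *_J z) *_J y *_J w + (z *_J w) *_J y *_J x + (w *_J x) *_J y *_J z =
  (x *_J z) *_J (y *_J w) + (z *_J w) *_J (y *_J x) + (w *_J x) *_J (y *_J z).
Proof.
pose P v : A := (v *_J v) *_J y *_J v - (v *_J v) *_J (y *_J v).
have P0 v : P v = 0 by rewrite /P jordan_identity subrr.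
apply/eqP; rewrite -subr_eq0; apply/eqP.
(* Inclusion-exclusion extracts the trilinear part of the cubic [P]; as [v *_J v] is symmetric, each
   term occurs twice. *)
transitivity (half (P (x + z + w) - P (x + z) - P (z + w) - P (x + w)
                    + P x + P z + P w)); last first.
  by rewrite !P0 !subr0 !addr0 scaler0.
rewrite /P; jalg two_neq0.
Qed.

Section Idempotent.
Variable e : A.
Hypothesis ee : e *_J e = e.

(** With [L] the multiplication by [e], this is [L (L - 1) (2 L - 1) = 0]. *)
Lemma peirce_cubic x :
  (e *_J (e *_J (e *_J x))) *+ 2 = (e *_J (e *_J x)) *+ 3 - e *_J x.
Proof.
have := jordan_linearized e e x e; rewrite !ee => H.
by lin 1%N H; jalg two_neq0.
Qed.

Lemma peirce_decomposition x : exists x1 t x0,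
  [/\ x = x1 + t + x0, e *_J x1 = x1, e *_J t = half t & e *_J x0 = 0].
Proof.
have H := peirce_cubic x.
(* The witnesses are the Lagrange interpolation polynomials in [L] at the nodes 1, 1/2, 0, applied
   to [x]. *)
exists ((e *_J (e *_J x)) *+ 2 - e *_J x).
exists ((e *_J x) *+ 4 - (e *_J (e *_J x)) *+ 4).
exists (x - (e *_J x) *+ 3 + (e *_J (e *_J x)) *+ 2).
split.
- by jalg two_neq0.
- by lin 1%N H; jalg two_neq0.
- by lin 2%N (esym H); jalg two_neq0.
- by lin 1%N H; jalg two_neq0.
Qed.

(* The boolean [l] is the Peirce eigenvalue, 0 or 1, of [a]. *)
Lemma peirce_comm (l : bool) a y :
  e *_J a = a *+ l -> e *_J (a *_J y) = a *_J (e *_J y).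
Proof.
move=> ea; have := jordan_linearized e e a y.
rewrite ee (jmulC a e) ea; case: l {ea} => /= H.
  by lin 1%N H; jalg two_neq0.
by lin 1%N (esym H); jalg two_neq0.
Qed.

Lemma peirce1_comm a y : e *_J a = a -> e *_J (a *_J y) = a *_J (e *_J y).
Proof. exact: (@peirce_comm true). Qed.

Lemma peirce0_comm a y : e *_J a = 0 -> e *_J (a *_J y) = a *_J (e *_J y).
Proof. exact: (@peirce_comm false). Qed.

(** Both multiplications commute with that by [e], so [a b] has eigenvalue 1 and eigenvalue 0. *)
Lemma peirce10 a b : e *_J a = a -> e *_J b = 0 -> a *_J b = 0.
Proof.
move=> ea eb; have := peirce0_comm a eb; rewrite ea (jmulC b) => <-.
by rewrite peirce1_comm // eb jmul0r.
Qed.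

(** [L^2 = L] on [s t] says that [s t] has no component in [A_{1/2}]. *)
Lemma peirce_half_mul s t :
    e *_J s = half s -> e *_J t = half t ->
  e *_J (e *_J (s *_J t)) = e *_J (s *_J t).
Proof.
move=> es et; have := jordan_linearized s t e e.
rewrite ee ![_ *_J e]jmulC !es !et !jmulZr !es !et => H.
lin 1%N H; jalg two_neq0.
Qed.

(** The components of [t^2] in [A_1] and [A_0] act equally on [t]. *)
Lemma peirce_half_cube t : e *_J t = half t ->
  (e *_J (t *_J t)) *_J t = half ((t *_J t) *_J t).
Proof.
move=> et; have := jordan_identity t e.
rewrite et => H; lin 1%N H; jalg two_neq0.
Qed.

(** On [A_{1/2}], the map sending [a] to twice its multiplication respects squares. *)
Lemma peirce_sqr_act (l : bool) a t :
    e *_J a = a *+ l -> e *_J t = half t ->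
  (a *_J a) *_J t = (a *_J (a *_J t)) *+ 2.
Proof.
move=> ea et; have := jordan_linearized a a t e.
rewrite ![_ *_J e]jmulC (jmulC t a) !(peirce_comm _ ea) ea et.
case: l {ea} => /= H; first by lin 2%N H; jalg two_neq0.
by lin 2%N (esym H); jalg two_neq0.
Qed.

Lemma peirce_act_comm a b t :
    e *_J a = a -> e *_J b = 0 -> e *_J t = half t ->
  a *_J (b *_J t) = b *_J (a *_J t).
Proof.
move=> ea eb et; have := jordan_linearized a b t e.
rewrite (peirce10 ea eb) !jmul0l ![_ *_J e]jmulC (jmulC t a).
rewrite (peirce1_comm _ ea) (peirce0_comm _ eb) ea eb et => H.
lin 2%N (esym H); jalg two_neq0.
Qed.

(** Once [a t = 0], the linearized identity reduces to [(1/2 - l) a t^2 = 0]. *)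
Lemma peirce_annihilate (l : bool) a t :
    e *_J a = a *+ l -> e *_J t = half t -> a *_J t = 0 ->
  a *_J (t *_J t) = 0.
Proof.
move=> ea et at0; have := jordan_linearized t a e t.
rewrite ![_ *_J e]jmulC (jmulC t a) at0 ea et.
rewrite jmulMnl at0; case: l {ea} => /= H.
  by lin 2%N (esym H); jalg two_neq0.
by lin 2%N H; jalg two_neq0.
Qed.

(** Here [2 a s = a^2 t = 0], whence [s^2 = a (s t)]; only the [A_1] part of [s t] survives
    multiplication by [a]. *)
Lemma peirce_nilpotent_act a t :
    e *_J a = a -> e *_J t = half t -> a *_J a = 0 ->
  e *_J ((a *_J t) *_J (a *_J t)) = (a *_J t) *_J (a *_J t).
Proof.
move=> ea et aa; set s := a *_J t.
have es : e *_J s = half s by rewrite /s peirce1_comm // et jmulZr.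
have as0 : a *_J s = 0.
  apply: (two_torsion_free two_neq0 (k := 1)).
  by rewrite -(@peirce_sqr_act true) // aa jmul0l.
have H : s *_J s = a *_J (s *_J t).
  have := jordan_linearized s a e t.
  rewrite ![_ *_J e]jmulC (jmulC s a) (jmulC t a) as0 ea es et -/s => H.
  by lin 2%N H; jalg two_neq0.
have H0 : e *_J (s *_J t - e *_J (s *_J t)) = 0.
  by rewrite jmulDr jmulNr peirce_half_mul // subrr.
rewrite H peirce1_comm //; apply/eqP; rewrite eq_sym -subr_eq0 -jmulNr -jmulDr.
by rewrite peirce10.
Qed.

(** [U_e = 2 L^2 - L] is the Peirce projection onto [A_1(e)]. *)
Lemma jU_imageP x : jU_image e x <-> e *_J x = x.
Proof.
split=> [[y _ <-]|ex]; last first.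
  by exists x => //; rewrite /jU ee jmulC !ex mulr2n addrK.
by rewrite /jU ee; lin 1%N (peirce_cubic y); jalg two_neq0.
Qed.

(** The difference [f - e] lies in [A_0(e)], so it kills [A_1(e)]. *)
Lemma idem_le_peirce1 f x :
  idem_le e f -> e *_J x = x -> f *_J x = x.
Proof.
move=> le_ef ex.
have : (x *_J (f - e)) = 0.
  by apply: peirce10 => //; rewrite jmulDr jmulNr ee le_ef subrr.
by rewrite jmulDr jmulNr !(jmulC x) ex => /eqP; rewrite subr_eq0 => /eqP.
Qed.

(** The Peirce components of [U_x e] are [x1^2], [2 x1 t] and the [A_0] part of [t^2]; applying [e]
    twice separates them. *)
Lemma jU_idem_eq0 x1 t x0 (x := x1 + t + x0) :
    e *_J x1 = x1 -> e *_J t = half t -> e *_J x0 = 0 -> jU x e = 0 ->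
  x1 *_J x1 = 0 /\ e *_J (t *_J t) = t *_J t.
Proof.
move=> e1 et e0 Ux.
have x10 := peirce10 e1 e0.
have ett := peirce_half_mul et et.
have U1 : x1 *_J x1 + (x1 *_J t) *+ 2 + (t *_J t - e *_J (t *_J t)) = 0.
  rewrite -{}Ux /jU.
  have -> : x *_J e = x1 + half t by rewrite jmulC !jmulDr e1 et e0 addr0.
  have -> : x *_J x *_J e = x1 *_J x1 + x1 *_J t + x0 *_J t + e *_J (t *_J t).
    have := (peirce1_comm x1 e1, peirce1_comm t e1, peirce1_comm x0 e1,
             peirce0_comm x0 e0, peirce0_comm t e0).
    rewrite e1 e0 et !jmul0r /x => -[[[[H1 H2] H5] H3] H4].
    lin 2%N H5; lin 1%N H1; lin 2%N H2.
    by lin 1%N H3; lin 2%N H4; jalg two_neq0.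
  by rewrite /x; lin 2%N (esym x10); jalg two_neq0.
have U2 := congr1 (jmul e) U1; rewrite jmul0r in U2.
have U3 := congr1 (jmul e) U2; rewrite jmul0r in U3.
have {U2} U2 : x1 *_J x1 + x1 *_J t = 0.
  rewrite -U2 !(jmulDr, jmulNr, jmulMnr) ett subrr addr0.
  by rewrite !(peirce1_comm _ e1) e1 et; jalg two_neq0.
have {U3} U3 : x1 *_J x1 + half (x1 *_J t) = 0.
  rewrite -U3 !(jmulDr, jmulNr, jmulMnr) !ett subrr addr0.
  by rewrite !(peirce1_comm _ e1) !e1 et jmulZr et; jalg two_neq0.
have x1t : x1 *_J t = 0.
  by lin 2%N U2; lin 2%N (esym U3); jalg two_neq0.
move: U2 U1; rewrite x1t addr0 => ->; rewrite mul0rn !add0r => /eqP.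
by rewrite subr_eq0 => /eqP <-.
Qed.

End Idempotent.

End Peirce.

(** * RJ-algebras *)

Section RickartJordan.
Variables (F : fieldType) (A : jordanAlgType F).
Hypothesis two_neq0 : 2%:R != 0 :> F.
Implicit Types a b c d e f g s t u x y z : A.

Local Notation half x := (2%:R^-1 *: x).

Definition annihilator_idem x e : Prop :=
  e *_J e = e /\ forall z, jU x (z *_J z) = 0 <-> e *_J (z *_J z) = z *_J z.

Lemma RJ_annihilator : RJ_algebra A -> forall x, exists e, annihilator_idem x e.
Proof.
move=> rj x; have [e ee eP] := rj x; exists e; split=> // z; split=> zP.
  have : (lperp [set x] `&` @jsquares F A) (z *_J z).
    by split; [move=> _ -> | exists z].
  by rewrite eP => -[/(jU_imageP two_neq0 ee)].
have : (jU_image e `&` @jsquares F A) (z *_J z).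
  by split; [exact/(jU_imageP two_neq0 ee) | exists z].
by rewrite -eP => -[+ _]; apply.
Qed.

(** Since [U_0 = 0], all squares lie in [A_1(u)]; polarization extends this to products. *)
Lemma RJ_unit : RJ_algebra A -> exists2 u,
  u *_J u = u & forall x y, u *_J (x *_J y) = x *_J y.
Proof.
move=> /RJ_annihilator/(_ 0)[u [uu uP]]; exists u => //.
have usq z : u *_J (z *_J z) = z *_J z.
  by apply/uP; rewrite /jU !jmul0l mul0rn subr0.
move=> x y.
have -> : x *_J y = half ((x + y) *_J (x + y) - x *_J x - y *_J y).
  by jalg two_neq0.
by rewrite jmulZr !(jmulDr u) !jmulNr !usq.
Qed.

Section WithUnit.
Hypothesis rj : RJ_algebra A.
Variable u : A.
Hypothesis uu : u *_J u = u.
Hypothesis umul : forall x y, u *_J (x *_J y) = x *_J y.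

Lemma unit_idem s : s *_J s = s -> u *_J s = s.
Proof. by move=> ss; rewrite -ss umul. Qed.

Lemma unit_half g t : g *_J t = half t -> u *_J t = t.
Proof.
by move=> gt; rewrite -(scale_halfD two_neq0 t) -gt jmulMnr umul.
Qed.

Lemma idem_complement s : s *_J s = s -> (u - s) *_J (u - s) = u - s.
Proof.
move=> ss; rewrite jmulDl !jmulDr !jmulNl !jmulNr uu (jmulC s u).
by rewrite unit_idem // ss opprK addNr addr0.
Qed.

(* [s^perp = u - s]: the idempotent [g] of [s] dominates [u - s], and the
   difference [h] satisfies [h = U_s g = 0]. *)
Lemma annihilator_idem_complement s :
  s *_J s = s -> annihilator_idem s (u - s).
Proof.
move=> ss; have [g [gg gP]] := RJ_annihilator rj s.
suff -> : u - s = g by [].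
have cc := idem_complement ss; set c := u - s in cc *.
have us := unit_idem ss; have ug := unit_idem gg.
have sc : s *_J c = 0 by rewrite /c jmulDr jmulNr ss jmulC us subrr.
have gc : g *_J c = c.
  have := (gP c).1; rewrite cc; apply.
  by rewrite /jU sc ss jmul0l mul0rn sc subrr.
have : jU s g = 0 by rewrite -gg; apply/gP; rewrite gg.
have sg : s *_J g = g - c.
  have -> : s = u - c by rewrite /c subKr.
  by rewrite jmulDl jmulNl ug jmulC gc.
rewrite /jU sg ss sg jmulDl jmulNl ![_ *_J s]jmulC sg sc subr0 mulr2n addrK.
by move=> /eqP; rewrite subr_eq0 eq_sym => /eqP.
Qed.

Lemma idem_perp s p : s *_J s = s -> p *_J p = p -> jU s p = 0 -> s *_J p = 0.
Proof.
move=> ss pp Usp; have [_ sP] := annihilator_idem_complement ss.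
have := (sP p).1; rewrite pp => /(_ Usp)/eqP.
by rewrite jmulDl jmulNl unit_idem // subr_eq addrC -subr_eq subrr eq_sym
   => /eqP.
Qed.

(* [g - t^2 + t] is an idempotent annihilated by [U_(u - g)], hence below
   [g]. *)
Lemma peirce_half_eq0 g t : g *_J g = g -> g *_J t = half t ->
  g *_J (t *_J t) = t *_J t -> t = 0.
Proof.
move=> gg gt gtt; set c := t *_J t in gtt *.
have ct : c *_J t = 0.
  have := peirce_half_cube two_neq0 gt; rewrite -/c gtt => H.
  by lin 2%N H; jalg two_neq0.
have cc : c *_J c = 0.
  exact: (peirce_annihilate two_neq0 (l := true) gtt gt ct).
set p := g - c + t.
have pp : p *_J p = p.
  transitivity (g *_J g + c *_J c + c - (g *_J c) *+ 2 + (g *_J t) *+ 2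
                - (c *_J t) *+ 2).
    by rewrite /p /c; jalg two_neq0.
  by rewrite gg cc gtt gt ct /p; jalg two_neq0.
have ut := unit_half gt.
have up : u *_J p = p by apply: unit_idem.
have gp : g *_J p = g - c + half t by rewrite /p !jmulDr jmulNr gg gtt gt.
have sp : (u - g) *_J p = half t.
  by rewrite jmulDl jmulNl up gp /p; jalg two_neq0.
have Usp : jU (u - g) p = 0.
  rewrite /jU idem_complement // sp (jmulC _ (u - g)).
  rewrite jmulZr jmulDl jmulNl ut gt.
  by jalg two_neq0.
have := idem_perp (idem_complement gg) pp Usp.
by rewrite sp => H; lin 2%N H; jalg two_neq0.
Qed.

Lemma jU_idem_split g x : g *_J g = g -> jU x g = 0 ->
  exists x1 x0, [/\ x = x1 + x0, g *_J x1 = x1, g *_J x0 = 0 & x1 *_J x1 = 0].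
Proof.
move=> gg.
have [x1 [t [x0 [-> g1 gt g0]]]] := peirce_decomposition two_neq0 gg x.
move=> /(jU_idem_eq0 two_neq0 gg g1 gt g0)[x11 /(peirce_half_eq0 gg gt) ->].
by exists x1, x0; rewrite addr0.
Qed.

(** For [j] attached to [d], [U_d d^2 = 0] puts [d^2] in [A_1(j)], while [U_d j = 0] makes [d^2] the
    square of the [A_0(j)] part of [d]. *)
Lemma square_nilpotent d : (d *_J d) *_J (d *_J d) = 0 -> d *_J d = 0.
Proof.
move=> dd; have [j [jj jP]] := RJ_annihilator rj d.
have jd : j *_J (d *_J d) = d *_J d.
  apply/jP; rewrite /jU dd subr0 (jmulC d (d *_J d)) jordan_identity dd.
  by rewrite mul0rn.
have Uj : jU d j = 0 by rewrite -jj; apply/jP; rewrite jj.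
have [d1 [d0 [Ed j1 j0 d11]]] := jU_idem_split jj Uj.
have Edd : d *_J d = d0 *_J d0.
  rewrite Ed jmulDl !jmulDr d11 (jmulC d0 d1) (peirce10 two_neq0 jj j1 j0).
  by rewrite !add0r.
by rewrite -jd Edd (peirce0_comm two_neq0 jj) // j0 jmul0r.
Qed.

(** Comparing Peirce components in [a = b^2] forces the [1/2]-component [t] of [b] to vanish; the
    [A_1] part of [a] is then a square of square zero. *)
Lemma annihilator_square_orthogonal b f :
  annihilator_idem (b *_J b) f -> f *_J (b *_J b) = 0.
Proof.
set a := b *_J b => -[ff fP].
have Uf : jU a f = 0 by rewrite -ff; apply/fP; rewrite ff.
have [b1 [t [b0 [Eb f1 ft f0]]]] := peirce_decomposition two_neq0 ff b.
have b10 := peirce10 two_neq0 ff f1 f0.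
have [a1 [a0 [Ea fa1 fa0 a11]]] := jU_idem_split ff Uf.
have ftt := peirce_half_mul two_neq0 ff ft ft.
pose T := f *_J (t *_J t).
have fb1 : f *_J (b1 *_J b1) = b1 *_J b1 by rewrite peirce1_comm ?f1.
have fb0 : f *_J (b0 *_J b0) = 0 by rewrite peirce0_comm ?f0 ?jmul0r.
have fb1t : f *_J (b1 *_J t) = half (b1 *_J t).
  by rewrite peirce1_comm // ft jmulZr.
have fb0t : f *_J (b0 *_J t) = half (b0 *_J t).
  by rewrite peirce0_comm // ft jmulZr.
have Eab : a1 + a0 = b1 *_J b1 + b0 *_J b0 + t *_J t + (b1 *_J t) *+ 2
                     + (b0 *_J t) *+ 2.
  rewrite -Ea /a Eb.
  by lin 2%N b10; jalg two_neq0.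
have Ea1 : a1 = b1 *_J b1 + T + b1 *_J t + b0 *_J t.
  have := congr1 (jmul f) Eab; rewrite !jmulDr fa1 fa0 fb1 fb0 fb1t fb0t.
  by rewrite -/T => H; lin 1%N H; jalg two_neq0.
(* This is the vanishing of the [A_{1/2}] component of [a]. *)
have b01 : b0 *_J t = - (b1 *_J t).
  have := congr1 (jmul f) Ea1; rewrite !jmulDr fa1 fb1 fb1t fb0t ftt -/T => H.
  lin 2%N H.
  by lin 2%N (esym Ea1); jalg two_neq0.
have {}Ea1 : a1 = b1 *_J b1 + T by rewrite Ea1 b01 addrK.
have Ea0 : a0 = b0 *_J b0 + (t *_J t - T).
  lin 1%N Eab.
  rewrite Ea1 b01; jalg two_neq0.
(* Both parts of [t^2] act equally on [t], and so do [b1^2] and [b0^2], by [b01] and the commuting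
   actions. *)
have a10t : a1 *_J t = a0 *_J t.
  rewrite Ea1 Ea0 !(jmulDl, jmulNl) (peirce_half_cube two_neq0 ft).
  rewrite (peirce_sqr_act two_neq0 ff (l := true) f1 ft).
  rewrite (peirce_sqr_act two_neq0 ff (l := false) f0 ft).
  rewrite b01 jmulNr -(peirce_act_comm two_neq0 ff f1 f0 ft) b01.
  by jalg two_neq0.
(* As [a1^2 = 0], the square of [a1 t] lies in [A_1(f)]. *)
have a1t : a1 *_J t = 0.
  apply: (peirce_half_eq0 ff); first by rewrite peirce1_comm // ft jmulZr.
  exact: peirce_nilpotent_act.
have a0t : a0 *_J t = 0 by rewrite -a10t.
have a1tt : a1 *_J (t *_J t) = 0.
  exact: (peirce_annihilate two_neq0 (l := true) fa1 ft a1t).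
have a0tt : a0 *_J (t *_J t) = 0.
  exact: (peirce_annihilate two_neq0 (l := false) fa0 ft a0t).
have a00tt : (a0 *_J a0) *_J (t *_J t) = 0.
  have fa00 : f *_J (a0 *_J a0) = 0 by rewrite peirce0_comm // fa0 jmul0r.
  apply: (peirce_annihilate two_neq0 (l := false) fa00 ft).
  by rewrite (peirce_sqr_act two_neq0 ff (l := false) fa0 ft) a0t jmul0r mul0rn.
(* The preceding products give [U_a (t^2) = 0], so [t^2] lies in [A_1(f)]. *)
have t0 : t = 0.
  apply: (peirce_half_eq0 ff ft); apply/fP.
  rewrite /jU Ea [_ *_J (t *_J t) in X in X - _]jmulDl a1tt a0tt addr0 jmul0l.
  rewrite mul0rn !(jmulDl, jmulDr) a11 (jmulC a0 a1).
  by rewrite (peirce10 two_neq0 ff fa1 fa0) !jmul0l a00tt !addr0 subr0.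
have b11 : b1 *_J b1 = 0.
  apply: square_nilpotent; rewrite -[b1 *_J b1]addr0.
  by move: a11; rewrite Ea1 /T t0 jmul0l jmul0r.
by rewrite Ea jmulDr fa1 fa0 addr0 Ea1 b11 /T t0 jmul0l jmul0r addr0.
Qed.

End WithUnit.

(** * BJ-algebras and the lattice of idempotents *)

Lemma BJ_RJ : BJ_algebra A -> RJ_algebra A.
Proof. by move=> bj x; apply: bj. Qed.

Lemma idem_partial_order : partial_order_on (idempotents A) (@idem_le F A).
Proof.
split=> // [x y _ _ xy yx|y x z Dx Dy Dz xy yz].
  by rewrite -xy jmulC yx.
rewrite /idem_le jmulC; apply: (idem_le_peirce1 two_neq0 Dy yz).
by rewrite jmulC.
Qed.

Lemma BJ_glb (S : set A) : BJ_algebra A -> S `<=` idempotents A ->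
  exists l, is_glb_in (idempotents A) (@idem_le F A) S l.
Proof.
move=> bj SD; have rj := BJ_RJ bj; have [u uu umul] := RJ_unit rj.
have [e ee eP] := bj [set u - s | s in S].
(* Since [u - (u - s) = s], the condition [U_(u - s) p = 0] on an idempotent [p] means [s p = p]. *)
have sP s : S s -> annihilator_idem (u - s) s.
  move=> Ss; have := annihilator_idem_complement rj uu umul
                       (idem_complement uu umul (SD s Ss)).
  by rewrite subKr.
exists e; split=> // [s Ss|v Dv vS].
  have : (lperp [set u - s | s in S] `&` @jsquares F A) e.
    by rewrite eP; split; [exact/(jU_imageP two_neq0 ee) | exists e].
  move=> [/(_ (u - s)) /(_ (ex_intro2 _ _ s Ss erefl)) Ue _].
  by have := ((sP s Ss).2 e).1; rewrite ee => /(_ Ue); rewrite /idem_le jmulC.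
have : (jU_image e `&` @jsquares F A) v.
  rewrite -eP; split; last by exists v.
  move=> _ [s Ss <-]; have := ((sP s Ss).2 v).2; rewrite Dv; apply.
  by rewrite jmulC; apply: vS.
by move=> [/(jU_imageP two_neq0 ee) + _]; rewrite /idem_le jmulC.
Qed.

Lemma BJ_complete_lattice :
  BJ_algebra A -> complete_lattice_on (idempotents A) (@idem_le F A).
Proof.
move=> bj; split; first exact: idem_partial_order.
move=> S SD; split; last exact: BJ_glb.
(* The supremum is the infimum of the upper bounds. *)
pose ub := idempotents A `&` [set v | forall x, S x -> idem_le x v].
have [u [Du uP uQ]] : exists l, is_glb_in (idempotents A) (@idem_le F A) ub l.
  by apply: BJ_glb => // v [].
exists u; split=> // [x Sx|v Dv vP]; last exact: uP.
by apply: uQ => [|v [_]]; [apply: SD | apply].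
Qed.

(* If [f] is the idempotent of the square [a], then [u - f] supports [a] and
   lies below every idempotent [e] with [a] in [U_e(A)], hence below their
   infimum. *)
Lemma RJ_complete_lattice_BJ :
    RJ_algebra A -> complete_lattice_on (idempotents A) (@idem_le F A) ->
  BJ_algebra A.
Proof.
move=> rj [_ cl] S; have [u uu umul] := RJ_unit rj.
pose E := [set e | exists2 x, S x & annihilator_idem x e].
have [|_ [l [ll lP lQ]]] := cl E; first by move=> e [x _ []].
exists l => //; apply/seteqP; split=> a [aP [b _ ba]]; split; try by exists b.
  move: aP; rewrite -{a}ba => aP.
  have [f afP] := RJ_annihilator rj (b *_J b); have [ff fP] := afP.
  have fa := annihilator_square_orthogonal rj uu umul afP.
  set a := b *_J b in aP fP fa *.
  have cc := idem_complement uu umul ff.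
  apply/(jU_imageP two_neq0 ll).
  apply: (idem_le_peirce1 two_neq0 cc); last first.
    by rewrite jmulDl jmulNl umul fa subr0.
  apply: lQ => // e [x Sx [ee eP]].
  have ea : e *_J a = a by apply/eP/aP.
  have ue : u *_J e = e by rewrite -ee umul.
  have dd := idem_complement uu umul ee.
  have Ud : jU a (u - e) = 0.
    have da : a *_J (u - e) = 0 by rewrite jmulC jmulDl jmulNl umul ea subrr.
    rewrite /jU da jmul0l mul0rn jmulC jmulDl jmulNl umul peirce1_comm //.
    by rewrite ea !subrr.
  (* From [f (u - e) = u - e] one gets [(u - f) e = u - f]. *)
  have := (fP (u - e)).1; rewrite dd => /(_ Ud).
  rewrite /idem_le !(jmulDl, jmulDr, jmulNl, jmulNr) ue.
  by rewrite (jmulC f u) unit_idem // => H; lin 1%N H; jalg two_neq0.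
move: aP => /(jU_imageP two_neq0 ll) la x Sx.
have [e axP] := RJ_annihilator rj x; have [ee eP] := axP.
rewrite -ba; apply/eP; rewrite ba.
by apply: (idem_le_peirce1 two_neq0 ll) la; apply: lP; exists x.
Qed.

End RickartJordan.

Theorem theorem2p5 (F : fieldType) (A : jordanAlgType F)
    (charF : 2%N \notin [pchar F]) :
  BJ_algebra A <->
  RJ_algebra A /\ complete_lattice_on (idempotents A) (@idem_le F A).
Proof.
have two_neq0 : 2%:R != 0 :> F by apply: contra charF => two0; apply/andP.
split=> [bj|[rj cl]]; last exact: RJ_complete_lattice_BJ.
by split; [exact: BJ_RJ | exact: BJ_complete_lattice].
Qed.
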